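(* Let $n\geq2$ and let $Z_n\subset\mathbb{R}^{n-1}\times\mathbb{R}=\mathbb{R}^n$ be the convex body with support function $$h_{Z_n}(x,t)=\mathbb{E}\,\bigl|\langle x,\Gamma_{n-1}\rangle+t\bigr|,\qquad (x,t)\in\mathbb{R}^{n-1}\times\mathbb{R},$$ where $\Gamma_{n-1}$ is a centered Gaussian random vector in $\mathbb{R}^{n-1}$ with covariance matrix $(\pi/2)I_{n-1}$. Let $s_0>0$ be the unique positive solution of $\operatorname{erf}(s_0/\sqrt\pi)=s_0e^{-s_0^2/\pi}$ and let $b_\infty:=e^{-s_0^2/\pi}\sqrt{1+s_0^2}$. Then $$d_{\mathrm{BM}}(Z_n,B_2^n)=b_\infty^{-1}.$$ Moreover, the Euclidean ball is, up to scaling, an optimal Banach--Mazur ellipsoid: there is $\rho>0$ such that $\rho B_2^n\subset Z_n\subset b_\infty^{-1}\rho B_2^n$.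
   Context: Convex bodies in $\mathbb{R}^n$ are compact, convex, origin-symmetric sets with nonempty interior. The support function of $K$ is $h_K(u)=\max_{y\in K}\langle u,y\rangle$. $B_2^n$ is the closed Euclidean unit ball of $\mathbb{R}^n$. The Banach--Mazur distance between origin-symmetric convex bodies $K,L\subset\mathbb{R}^n$ is $d_{\mathrm{BM}}(K,L)=\inf\{a\geq1: L\subset TK\subset aL\text{ for some }T\in GL(n,\mathbb{R})\}$; in particular $d_{\mathrm{BM}}(K,B_2^n)$ is the infimum of all $a\geq1$ such that $E\subset K\subset aE$ for some origin-centered ellipsoid $E$. The error function is $\operatorname{erf}(a)=\frac{2}{\sqrt\pi}\int_0^a e^{-r^2}\,dr$. It is a known fact that the equation $\operatorname{erf}(s/\sqrt\pi)=se^{-s^2/\pi}$ has exactly one positive solution. *)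

(* Defs.v *)
From HB Require Import structures.
From mathcomp Require Import all_boot all_order all_algebra.
From mathcomp Require Import all_classical all_reals all_analysis.

Set Implicit Arguments.
Unset Strict Implicit.
Unset Printing Implicit Defensive.

Import Order.TTheory GRing.Theory Num.Theory.
Import numFieldNormedType.Exports.

Local Open Scope classical_set_scope.
Local Open Scope ring_scope.

(* Vectors of R^k are row vectors. The library norm `|x| on 'rV[R]_k is the sup
   norm, hence the explicit Euclidean structure. *)
Definition dot (R : realType) (k : nat) (u v : 'rV[R]_k) : R :=
  \sum_(i < k) u 0 i * v 0 i.

Definition euclidean_norm (R : realType) (k : nat) (u : 'rV[R]_k) : R :=
  Num.sqrt (dot u u).

Definition euclidean_ball (R : realType) (k : nat) : set 'rV[R]_k :=
  [set u | euclidean_norm u <= 1].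

Definition convex_body (R : realType) (k : nat) (K : set 'rV[R]_k) : Prop :=
  [/\ compact K,
      convex_set K,
      forall x, K x -> K (- x)
    & K° !=set0].

(* For compact nonempty K the supremum is attained. *)
Definition support_function (R : realType) (k : nat) (K : set 'rV[R]_k)
    (u : 'rV[R]_k) : R :=
  sup [set dot u y | y in K].

Definition dilate (R : realType) (k : nat) (a : R) (K : set 'rV[R]_k) :
  set 'rV[R]_k := [set a *: x | x in K].

(* Linear maps act on row vectors by right multiplication. *)
Definition linear_image (R : realType) (k : nat) (T : 'M[R]_k)
  (K : set 'rV[R]_k) : set 'rV[R]_k := [set x *m T | x in K].

Definition banach_mazur (R : realType) (k : nat) (K L : set 'rV[R]_k) : R :=
  inf [set a : R | 1 <= a /\
        exists2 T : 'M[R]_k, T \in unitmx &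
          L `<=` linear_image T K /\ linear_image T K `<=` dilate a L].

(* The difference of the two integrals is the oriented integral from 0 to a:
   the first one vanishes for a <= 0 and the second one for a >= 0. *)
Definition erf (R : realType) (a : R) : R :=
  2 / Num.sqrt pi *
  (\int[lebesgue_measure]_(r in `[0, a]) expR (- r ^+ 2)
   - \int[lebesgue_measure]_(r in `[a, 0]) expR (- r ^+ 2)).

(* Gaussian laws on the line with mean m and standard deviation s, including the
   degenerate ones (s = 0), for which normal_prob m 0 is not the Dirac mass. *)
Definition gaussian_law (R : realType) (mu : set R -> \bar R) : Prop :=
  exists m s : R, 0 <= s /\
    forall A : set R, measurable A ->
      mu A = if s == 0 then \d_m A else normal_prob m s A.

(* A random vector is Gaussian when all linear forms of it have Gaussian laws. *)
Definition centered_gaussian_vector (R : realType) (d : measure_display)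
    (Omega : measurableType d) (P : probability Omega R) (k : nat)
    (X : 'I_k -> {RV P >-> R}) (Sigma : 'M[R]_k) : Prop :=
  [/\ forall x : 'rV[R]_k,
        gaussian_law (pushforward P (fun w => \sum_(i < k) x 0 i * X i w)),
      forall i, ('E_P[X i] = 0)%E
    & forall i j, covariance P (X i) (X j) = (Sigma i j)%:E].

(* Main.v *)
(* With r = |x|, the support function is h(x, t) = r phi(t / r), where
   phi(s) = exp(-s^2/pi) + s erf(s / sqrt pi).  Since phi' = erf(. / sqrt pi),
   the derivative of phi(s)^2 / (1 + s^2) has the sign of
   w(s) = erf(s / sqrt pi) - s exp(-s^2/pi), which is negative before s0 and
   positive after it.  Hence b |u| <= h(u) <= |u|, with equality on the left in
   the directions t = +- s0 |x| and on the right for t = 0 and for x = 0, so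
   that Z lies between b B and B.  For the lower bound, suppose that an inner
   product norm q satisfies q <= h <= a q, and take unit vectors e in R^(n-1)
   and f along the last axis.  The parallelogram law for e and s0 f gives
   2 (1 + s0^2) <= 2 a^2 (q(e)^2 + q(s0 f)^2)
   = a^2 (q(e + s0 f)^2 + q(e - s0 f)^2) <= 2 a^2 b^2 (1 + s0^2). *)

Require Import Defs.
From HB Require Import structures.
From mathcomp Require Import all_boot all_order all_algebra.
From mathcomp Require Import all_classical all_reals all_analysis.
From mathcomp Require Import measurable_realfun ring lra.

Set Implicit Arguments.
Unset Strict Implicit.
Unset Printing Implicit Defensive.

Import Order.TTheory GRing.Theory Num.Theory.
Import numFieldNormedType.Exports.

Local Open Scope classical_set_scope.
Local Open Scope ring_scope.

(** * The error function *)

Lemma is_derive_continuous (R : realType) (f df : R -> R) :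
  (forall z : R, is_derive z 1 f (df z)) -> continuous f.
Proof.
move=> fdf z; apply: differentiable_continuous.
by apply/derivable1_diffP; exact: (@ex_derive _ _ _ _ _ _ _ (fdf z)).
Qed.

Section erf_facts.
Context {R : realType}.
Implicit Types x y : R.
Notation mu := (@lebesgue_measure R).

Lemma integrable_gauss (D : set R) : measurable D ->
  mu.-integrable D (EFin \o @gauss_fun R).
Proof.
by move=> mD; apply: integrableS integrableT_gauss.
Qed.

(** Integrals starting at minus infinity turn the two-sided definition into one formula for both
    signs of [x], to which the fundamental theorem of calculus applies at every point. *)
Lemma erf_eq_Ny x :
  erf x = 2 / Num.sqrt pi *
    (\int[mu]_(r in `]-oo, x]) gauss_fun r - \int[mu]_(r in `]-oo, 0]) gauss_fun r).
Proof.
rewrite /erf; congr (_ * _).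
have itvE (a b : R) : a <= b ->
    \int[mu]_(r in `]-oo, b]) gauss_fun r - \int[mu]_(r in `]-oo, a]) gauss_fun r
    = \int[mu]_(r in `[a, b]) gauss_fun r.
  move=> ab; rewrite Rintegral_itvB//; last exact: integrable_gauss.
  by rewrite Rintegral_itv_obnd_cbnd//; exact: integrable_gauss.
have itvE0 (a b : R) : b <= a -> \int[mu]_(r in `[a, b]) gauss_fun r = 0.
  rewrite le_eqVlt => /predU1P[->|ba].
    by rewrite set_itv1 Rintegral_set1.
  by rewrite set_itv_ge ?Rintegral_set0// bnd_simp -ltNge.
have [x0|x0] := leP 0 x.
  by rewrite (itvE0 x 0)// subr0 -itvE.
by rewrite (itvE0 0 x) ?ltW// sub0r -itvE ?ltW// opprB.
Qed.

Lemma is_derive_erf x : is_derive x 1 (@erf R) (2 / Num.sqrt pi * expR (- x ^+ 2)).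
Proof.
have -> : @erf R = (fun x => 2 / Num.sqrt pi *
    (\int[mu]_(r in `]-oo, x]) gauss_fun r - \int[mu]_(r in `]-oo, 0]) gauss_fun r)).
  by apply/funext => z; rewrite erf_eq_Ny.
have xx1 : x < x + 1 by rewrite ltrDl.
have iF := @integrable_gauss `]-oo, x + 1] (measurable_itv _).
have [dF F'] := continuous_FTC1 xx1 iF (ltNyr _) (@continuous_gauss_fun R x).
have h : is_derive x 1 (fun y => \int[mu]_(r in `]-oo, y]) gauss_fun r) (gauss_fun x).
  exact: (DeriveDef dF (etrans (esym (derive1E _ _)) F')).
apply: is_derive_eq.
by rewrite subr0 /gauss_fun /GRing.scale/= ?mulr0 ?addr0.
Qed.

Lemma continuous_erf : continuous (@erf R).
Proof. exact: is_derive_continuous is_derive_erf. Qed.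

Lemma erf0 : erf (0 : R) = 0.
Proof. by rewrite erf_eq_Ny subrr mulr0. Qed.

Lemma sqrt_pi_gt0 : 0 < Num.sqrt (pi : R).
Proof. by rewrite sqrtr_gt0 pi_gt0. Qed.

(** The function [erf (- z) + erf z] has zero derivative and vanishes at 0. *)
Lemma erfN x : erf (- x) = - erf x.
Proof.
have dh y : is_derive y (1 : R) (fun z : R => erf (- z) + erf z : R) 0.
  have d1 := is_derive_erf y.
  have dN : is_derive y (1 : R) (-%R : R -> R) (-1) by exact: is_deriveNid.
  have d2 : is_derive y (1 : R) (fun z => erf (- z) : R)
      (2 / Num.sqrt pi * expR (- (- y) ^+ 2) * -1).
    exact: (@is_derive1_comp R (@erf R) -%R y _ _ (is_derive_erf (- y)) dN).
  apply: is_derive_eq; by rewrite sqrrN mulrN1 addNr.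
have : (fun z : R => erf (- z) + erf z : R) x = (fun z : R => erf (- z) + erf z : R) 0.
  exact: is_derive_0_is_cst.
by rewrite oppr0 erf0 addr0 => /eqP; rewrite addr_eq0 => /eqP.
Qed.

Lemma cvg_erfy : erf x @[x --> +oo] --> (1 : R).
Proof.
have c : gauss_integral_proof.integral0_gauss x @[x --> +oo] --> Num.sqrt (pi : R) / 2.
  (* The Gaussian integral is known through the limit pi / 4 of its square; the root is harmless
     because the integral is nonnegative. *)
  have : Num.sqrt (@gauss_integral_proof.integral0_gauss R x ^+ 2) @[x --> +oo]
      --> Num.sqrt (pi / 4 : R).
    apply: continuous_cvg; first exact: sqrt_continuous.
    exact: gauss_integral_proof.cvg_integral0_gauss_sqr.
  rewrite sqrtrM ?pi_ge0// sqrtrV// (_ : 4 = 2 ^+ 2); last by rewrite expr2 -natrM.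
  rewrite sqrtr_sqr ger0_norm//.
  under eq_fun do rewrite sqrtr_sqr ger0_norm ?gauss_integral_proof.integral0_gauss_ge0//.
  by [].
have : 2 / Num.sqrt pi * gauss_integral_proof.integral0_gauss x @[x --> +oo]
    --> 2 / Num.sqrt pi * (Num.sqrt (pi : R) / 2).
  by apply: cvgMl_tmp.
rewrite (_ : 2 / _ * _ = 1); last first.
  by field; rewrite gt_eqF// sqrt_pi_gt0.
apply: cvg_trans; apply: near_eq_cvg; near=> x.
rewrite /erf /gauss_integral_proof.integral0_gauss; congr (_ * _).
rewrite [X in _ - X](_ : _ = 0) ?subr0//.
have x0 : 0 < x by near: x; exact: nbhs_pinfty_gt.
by rewrite set_itv_ge ?Rintegral_set0// bnd_simp -ltNge.
Unshelve. all: by end_near. Qed.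

Lemma ndecr_erf x y : x <= y -> erf x <= erf y.
Proof.
move=> xy; apply: (@ger0_derive1_ndecrNy R (@erf R) y _ _ _ x y xy (lexx y)).
- move=> z _; exact: (@ex_derive _ _ _ _ _ _ _ (is_derive_erf z)).
- move=> z _; rewrite derive1E (@derive_val _ _ _ _ _ _ _ (is_derive_erf z)).
  by rewrite mulr_ge0// ?expR_ge0// divr_ge0// sqrtr_ge0.
- by apply: continuous_subspaceT => z; exact: continuous_erf.
Qed.

Lemma erf_le1 x : erf x <= 1.
Proof.
apply: (cvgr_to_ge cvg_erfy); near=> y.
by apply: ndecr_erf; near: y; apply: nbhs_pinfty_ge; exact: num_real.
Unshelve. all: by end_near. Qed.

End erf_facts.

(** * The profile of the zonoid *)

Section zonoid_profile.
Context {R : realType}.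
Implicit Types (s x y : R) (f df : R -> R).

Lemma is_derive_MVT f df x y :
  (forall z : R, is_derive z 1 f (df z)) -> x < y ->
  exists2 c, x < c < y & f y - f x = df c * (y - x).
Proof.
move=> fdf xy.
have cf : {within `[x, y], continuous f}.
  by apply: continuous_subspaceT; exact: is_derive_continuous fdf.
have [c cxy fE] := MVT xy (fun z _ => fdf z) cf.
by exists c => //; move: cxy; rewrite in_itv.
Qed.

Lemma is_derive_ge0_le f df x y :
  (forall z : R, is_derive z 1 f (df z)) -> x <= y ->
  (forall z, x < z < y -> 0 <= df z) -> f x <= f y.
Proof.
move=> fdf; rewrite le_eqVlt => /predU1P[-> //|xy] df0.
have [c cxy fE] := is_derive_MVT fdf xy.
by rewrite -subr_ge0 fE mulr_ge0 ?df0// subr_ge0 ltW.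
Qed.

Lemma is_derive_expR_sqr (k : R) x :
  is_derive x 1 (fun y => expR (- (y ^+ 2 / k))) (expR (- (x ^+ 2 / k)) * (- (x * 2 / k))).
Proof.
suff d : is_derive x 1 (fun y => - (y ^+ 2 / k)) (- (x * 2 / k)).
  exact: (@is_derive1_comp R expR _ x _ _ (is_derive_expR _) d).
rewrite (_ : (fun y => _) = (fun y => (- k^-1) *: (y * y : R))); last first.
  by apply/funext => y; rewrite /GRing.scale/= expr2 mulNr mulrC.
apply: is_derive_eq.
by rewrite /GRing.scale/= !mulr1; ring.
Qed.

Lemma is_derive_erf_scale (k : R) x :
  is_derive x 1 (fun y => erf (y / k)) (2 / Num.sqrt pi * expR (- (x / k) ^+ 2) / k).
Proof.
suff d : is_derive x 1 (fun y => y / k) k^-1.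
  exact: (@is_derive1_comp R (@erf R) _ x _ _ (is_derive_erf _) d).
rewrite (_ : (fun y => _) = (fun y => k^-1 *: (y : R))); last first.
  by apply/funext => y; rewrite /GRing.scale/= mulrC.
apply: is_derive_eq.
by rewrite /GRing.scale/= mulr1.
Qed.

(* h_Z (x, t) = |x| * profile (t / |x|) for x <> 0. *)
Definition profile s := expR (- (s ^+ 2 / pi)) + s * erf (s / Num.sqrt pi).

(* This is profile' (s) * (1 + s^2) - s * profile s. *)
Definition profile_wronskian s :=
  erf (s / Num.sqrt pi) - s * expR (- (s ^+ 2 / pi)).

Let sqr_div_sqrt_pi s : (s / Num.sqrt pi) ^+ 2 = s ^+ 2 / pi.
Proof. by rewrite expr_div_n sqr_sqrtr// pi_ge0. Qed.

Let dexp s := is_derive_expR_sqr pi s.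

Let derf s : is_derive s 1 (fun y => erf (y / Num.sqrt pi))
  (2 / pi * expR (- (s ^+ 2 / pi))).
Proof.
apply: (is_derive_eq (is_derive_erf_scale (Num.sqrt pi) s)).
rewrite sqr_div_sqrt_pi.
have := @sqrt_pi_gt0 R; have := @sqr_sqrtr _ (pi : R) (pi_ge0 R).
by move: (expR _) (Num.sqrt _) => e t <- t0; field; rewrite gt_eqF.
Qed.

Lemma is_derive_profile s : is_derive s 1 profile (erf (s / Num.sqrt pi)).
Proof.
have d1 := dexp s; have d2 := derf s.
rewrite /profile; apply: is_derive_eq.
rewrite /GRing.scale/= mulr1; ring.
Qed.

Lemma is_derive_profile_wronskian s : is_derive s 1 profile_wronskian
  (expR (- (s ^+ 2 / pi)) * (2 / pi - 1 + 2 * s ^+ 2 / pi)).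
Proof.
have d1 := dexp s; have d2 := derf s.
rewrite /profile_wronskian; apply: is_derive_eq.
rewrite /GRing.scale/= mulr1; ring.
Qed.

Lemma profile_gt0 s : 0 <= s -> 0 < profile s.
Proof.
move=> s0; rewrite ltr_pwDl ?expR_gt0// mulr_ge0//.
by rewrite -erf0 ndecr_erf// divr_ge0// sqrtr_ge0.
Qed.

(** The value of h(x, t)^2 / |(x, t)|^2 in the directions t = s |x|; squaring avoids the root in the
    Euclidean norm. *)
Definition profile_ratio s := profile s ^+ 2 / (1 + s ^+ 2).

Lemma is_derive_profile_ratio s : is_derive s 1 profile_ratio
  (2 * profile s * profile_wronskian s / (1 + s ^+ 2) ^+ 2).
Proof.
have d1 := is_derive_profile s.
have s1 : 1 + s * s != 0 by rewrite -expr2 gt_eqF// ltr_pwDl// sqr_ge0.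
have d2 : is_derive s 1 (fun y : R => 1 + y * y) (2 * s).
  by apply: is_derive_eq; rewrite /GRing.scale/= !mulr1; ring.
have d3 := @is_deriveV R _ s _ 1 s1 d2.
rewrite (_ : profile_ratio = (fun y => profile y * profile y * (1 + y * y)^-1)); last first.
  by apply/funext => y; rewrite /profile_ratio !expr2.
apply: is_derive_eq.
rewrite /GRing.scale/= /profile_wronskian /profile.
by field.
Qed.

Variable s0 : R.
Hypotheses (s0_gt0 : 0 < s0) (s0E : profile_wronskian s0 = 0).

Let wronskian0 : profile_wronskian 0 = 0.
Proof. by rewrite /profile_wronskian !mul0r erf0 subr0. Qed.

Let pi0 := pi_gt0 R.

(** The derivative of the Wronskian is a positive exponential times a factor that increases on the
    half-line, so once positive it stays positive. *)
Let dw_gt0 x y : 0 <= x -> x <= y ->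
  0 < expR (- (x ^+ 2 / pi)) * (2 / pi - 1 + 2 * x ^+ 2 / pi) ->
  0 < expR (- (y ^+ 2 / pi)) * (2 / pi - 1 + 2 * y ^+ 2 / pi).
Proof.
move=> x0 xy; rewrite !pmulr_rgt0 ?expR_gt0// => /lt_le_trans; apply.
by rewrite lerD2l ler_pM2r ?invr_gt0// ler_pM2l// ler_sqr ?nnegrE// (le_trans x0).
Qed.

(** The Wronskian vanishes at 0 and at [s0]. A positive value at [s] would force a positive
    derivative somewhere before [s], hence everywhere after that point, and the Wronskian could not
    return to 0 at [s0]. *)
Lemma wronskian_le0 s : 0 <= s <= s0 -> profile_wronskian s <= 0.
Proof.
move=> /andP[]; rewrite le_eqVlt => /predU1P[<-|s_gt0].
  by rewrite wronskian0.
rewrite le_eqVlt => /predU1P[->|ss0]; first by rewrite s0E.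
rewrite leNgt; apply/negP => ws.
have [c /andP[c0 cs]] := is_derive_MVT is_derive_profile_wronskian s_gt0.
rewrite wronskian0 !subr0 => wE.
move: ws; rewrite wE pmulr_lgt0// => dc.
have ws : 0 < profile_wronskian s by rewrite wE mulr_gt0.
have [e /andP[se es0]] := is_derive_MVT is_derive_profile_wronskian ss0.
rewrite s0E sub0r => wE'.
have : 0 < - profile_wronskian s.
  rewrite wE' mulr_gt0 ?subr_gt0//; apply: dw_gt0 dc; rewrite ltW//.
  exact: lt_trans se.
by rewrite oppr_gt0 ltNge (ltW ws).
Qed.

(** By Rolle the derivative vanishes at some [e] between 0 and [s0], so it is nonnegative beyond
    [e]. A negative value at [s] would need a negative derivative at some [c] beyond [s0]. *)
Lemma wronskian_ge0 s : s0 <= s -> 0 <= profile_wronskian s.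
Proof.
rewrite le_eqVlt => /predU1P[<-|s0s]; first by rewrite s0E.
rewrite leNgt; apply/negP => ws.
have [c /andP[c0 cs]] := is_derive_MVT is_derive_profile_wronskian s0s.
rewrite s0E subr0 => wE.
have [e /andP[se es0]] := is_derive_MVT is_derive_profile_wronskian s0_gt0.
rewrite s0E wronskian0 !subr0 => /esym/eqP; rewrite mulf_eq0 (gt_eqF s0_gt0) orbF => /eqP de.
move: ws; rewrite wE pmulr_llt0 ?subr_gt0// => dc.
have ec : e <= c by rewrite ltW// (lt_trans es0).
move: de dc => /eqP; rewrite mulf_eq0 gt_eqF ?expR_gt0//= => /eqP de.
rewrite pmulr_rlt0 ?expR_gt0//; apply/negP; rewrite -leNgt -[leLHS]de.
have e_ge0 : 0 <= e by exact: ltW.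
by rewrite lerD2l ler_pM2r ?invr_gt0// ler_pM2l// ler_sqr ?nnegrE// (le_trans e_ge0).
Qed.

(** The derivative of the ratio has the sign of the Wronskian, so the ratio decreases up to [s0] and
    increases afterwards. *)
Lemma profile_ratio_ge s : 0 <= s -> profile_ratio s0 <= profile_ratio s.
Proof.
move=> s_ge0; have [ss0|s0s] := leP s s0; last first.
  apply: (is_derive_ge0_le is_derive_profile_ratio (ltW s0s)) => z /andP[zs0 _].
  have z0 : 0 <= z by rewrite ltW// (lt_trans s0_gt0).
  by rewrite divr_ge0 ?sqr_ge0// !mulr_ge0// ?wronskian_ge0 ?ltW// profile_gt0.
rewrite -lerN2; apply: (@is_derive_ge0_le (fun x => - profile_ratio x)
    (fun x => - (2 * profile x * profile_wronskian x / (1 + x ^+ 2) ^+ 2)) _ _ _ ss0).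
  by move=> z; have dz := is_derive_profile_ratio z; exact: is_deriveN.
move=> z /andP[sz zs0]; have z0 : 0 <= z by rewrite (le_trans s_ge0)// ltW.
rewrite -mulNr -mulrN divr_ge0 ?sqr_ge0// mulr_ge0 ?oppr_ge0 ?wronskian_le0 ?z0 ?ltW//.
by rewrite mulr_gt0// profile_gt0.
Qed.

(** Up to [s0] the ratio decreases from its value 1 at 0; beyond [s0] it increases, and its limit at
    infinity is at most 1. *)
Lemma profile_ratio_le1 s : 0 <= s -> profile_ratio s <= 1.
Proof.
move=> s_ge0; have [ss0|s0s] := leP s s0.
  rewrite (_ : 1 = profile_ratio 0); last first.
    by rewrite /profile_ratio /profile expr0n/= !mul0r oppr0 expR0 !addr0 expr1n divr1.
  rewrite -lerN2; apply: (@is_derive_ge0_le (fun x => - profile_ratio x)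
    (fun x => - (2 * profile x * profile_wronskian x / (1 + x ^+ 2) ^+ 2)) _ _ _ s_ge0).
    by move=> z; have dz := is_derive_profile_ratio z; exact: is_deriveN.
  move=> z /andP[z0 zs].
  rewrite -mulNr -mulrN divr_ge0 ?sqr_ge0// mulr_ge0 ?oppr_ge0//.
    by rewrite mulr_ge0// ltW// profile_gt0// ltW.
  by rewrite wronskian_le0// ltW//= (le_trans (ltW zs)).
apply/ler_addgt0Pr => e e0.
(* Since [profile S <= 1 + S], the ratio at [S] is at most 1 + 2 S / (1 + S^2), which is at most 1 +
   e as soon as 2 <= e S. *)
pose S := s + 2 / e.
have e2 : 0 < 2 / e by rewrite divr_gt0.
have S0 : 0 < S by rewrite ltr_wpDl.
have sS : s <= S by rewrite lerDl ltW.
apply: (@le_trans _ _ (profile_ratio S)).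
  apply: (is_derive_ge0_le is_derive_profile_ratio sS) => z /andP[zs _].
  have z0 : 0 <= z by rewrite (le_trans s_ge0)// ltW.
  rewrite divr_ge0 ?sqr_ge0// !mulr_ge0// ?wronskian_ge0 ?ltW ?profile_gt0//.
  exact: lt_trans zs.
have S1 : 0 < 1 + S ^+ 2 by rewrite ltr_pwDl// sqr_ge0.
have pS : profile S <= 1 + S.
  rewrite lerD//.
    by rewrite -expR0 ler_expR oppr_le0 divr_ge0 ?sqr_ge0 ?ltW.
  by rewrite ler_piMr ?erf_le1// ltW.
have p0 := profile_gt0 (ltW S0).
have eS : 2 <= e * S.
  rewrite mulrDr (mulrC e (2 / e)) divfK ?gt_eqF// lerDr mulr_ge0// ltW//.
rewrite /profile_ratio ler_pdivrMr//.
move: (profile S) p0 pS => p p0 pS; nra.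
Qed.

(** The equation for [s0] eliminates [erf] and gives profile(s0) = exp(-s0^2/pi) (1 + s0^2); the
    minimal ratio is thus the square of the constant b of the theorem. *)
Lemma profile_ratio_min : profile_ratio s0 = expR (- (s0 ^+ 2 / pi)) ^+ 2 * (1 + s0 ^+ 2).
Proof.
move/eqP : s0E; rewrite subr_eq0 => /eqP eE.
rewrite /profile_ratio /profile eE.
have : 1 + s0 ^+ 2 != 0 by rewrite gt_eqF// ltr_pwDl// sqr_ge0.
by move: (expR _) => e ?; field.
Qed.

End zonoid_profile.

(** * Euclidean structure, support functions and ellipsoids *)

Section euclidean_structure.
Context {R : realType}.
Implicit Types (k : nat) (a : R).

Lemma dot_mx k (u v : 'rV[R]_k) : dot u v = (u *m v^T) 0 0.
Proof. by rewrite mxE; apply: eq_bigr => i _; rewrite mxE. Qed.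

Lemma dotC k (u v : 'rV[R]_k) : dot u v = dot v u.
Proof. by apply: eq_bigr => i _; rewrite mulrC. Qed.

Lemma dotDr k (u v w : 'rV[R]_k) : dot u (v + w) = dot u v + dot u w.
Proof. by rewrite -big_split; apply: eq_bigr => i _; rewrite mxE mulrDr. Qed.

Lemma dotZr k a (u v : 'rV[R]_k) : dot u (a *: v) = a * dot u v.
Proof. by rewrite mulr_sumr; apply: eq_bigr => i _; rewrite mxE mulrCA. Qed.

Lemma dotNr k (u v : 'rV[R]_k) : dot u (- v) = - dot u v.
Proof. by rewrite -scaleN1r dotZr mulN1r. Qed.

Lemma dotDl k (u v w : 'rV[R]_k) : dot (v + w) u = dot v u + dot w u.
Proof. by rewrite dotC dotDr !(dotC u). Qed.

Lemma dotZl k a (u v : 'rV[R]_k) : dot (a *: v) u = a * dot v u.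
Proof. by rewrite dotC dotZr (dotC u). Qed.

Lemma dotNl k (u v : 'rV[R]_k) : dot (- v) u = - dot v u.
Proof. by rewrite dotC dotNr dotC. Qed.

Definition dotE := (dotDr, dotDl, dotZr, dotZl, dotNr, dotNl).

Lemma dot_ge0 k (u : 'rV[R]_k) : 0 <= dot u u.
Proof. by apply: sumr_ge0 => i _; rewrite -expr2 sqr_ge0. Qed.

Lemma dot_eq0 k (u : 'rV[R]_k) : (dot u u == 0) = (u == 0).
Proof.
apply/idP/eqP => [/eqP u0|->]; last first.
  by rewrite /dot big1// => i _; rewrite mxE mul0r.
have i0 (i : 'I_k) : 0 <= u 0 i * u 0 i by rewrite -expr2 sqr_ge0.
apply/rowP => i; rewrite mxE.
have := psumr_eq0P (fun j _ => i0 j) u0 (i := i) isT.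
by move/eqP; rewrite mulf_eq0 orbb => /eqP.
Qed.

Lemma euclidean_norm_ge0 k (u : 'rV[R]_k) : 0 <= euclidean_norm u.
Proof. exact: sqrtr_ge0. Qed.

Lemma sqr_euclidean_norm k (u : 'rV[R]_k) : euclidean_norm u ^+ 2 = dot u u.
Proof. by rewrite sqr_sqrtr// dot_ge0. Qed.

Lemma euclidean_norm_eq0 k (u : 'rV[R]_k) : (euclidean_norm u == 0) = (u == 0).
Proof. by rewrite -dot_eq0 -sqr_euclidean_norm sqrf_eq0. Qed.

Lemma euclidean_normZ k a (u : 'rV[R]_k) :
  euclidean_norm (a *: u) = `|a| * euclidean_norm u.
Proof.
by rewrite /euclidean_norm !dotE mulrA -expr2 sqrtrM ?sqr_ge0// sqrtr_sqr.
Qed.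

Lemma dot_le_norm k (u v : 'rV[R]_k) : dot u v <= euclidean_norm u * euclidean_norm v.
Proof.
have [/eqP|u0] := eqVneq (euclidean_norm u) 0.
  rewrite euclidean_norm_eq0 => /eqP ->; rewrite /euclidean_norm.
  by rewrite -(scale0r 0) !dotE !mul0r sqrtr0 mul0r.
have [/eqP|v0] := eqVneq (euclidean_norm v) 0.
  rewrite euclidean_norm_eq0 => /eqP ->; rewrite /euclidean_norm.
  by rewrite -(scale0r 0) !dotE !mul0r sqrtr0 mulr0.
(* Cauchy-Schwarz: expand this square and divide by twice the product of the two norms. *)
have := dot_ge0 (euclidean_norm v *: u - euclidean_norm u *: v).
rewrite !dotE -!sqr_euclidean_norm (dotC v u).
have u1 : 0 < euclidean_norm u by rewrite lt_neqAle eq_sym u0 euclidean_norm_ge0.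
have v1 : 0 < euclidean_norm v by rewrite lt_neqAle eq_sym v0 euclidean_norm_ge0.
have uv1 : 0 < euclidean_norm u * euclidean_norm v by rewrite mulr_gt0.
move: (euclidean_norm u) (euclidean_norm v) (dot u v) uv1 => p q d uv1 h.
rewrite -(ler_pM2l uv1); lra.
Qed.

Lemma dot_mulmx k (u v : 'rV[R]_k) (T : 'M[R]_k) : dot u (v *m T) = dot (u *m T^T) v.
Proof. by rewrite !dot_mx trmx_mul mulmxA. Qed.

Lemma parallelogram k (u v : 'rV[R]_k) :
  euclidean_norm (u + v) ^+ 2 + euclidean_norm (u - v) ^+ 2 =
  2 * (euclidean_norm u ^+ 2 + euclidean_norm v ^+ 2).
Proof. by rewrite !sqr_euclidean_norm !dotE; ring. Qed.

Lemma dilate_ballE k a (x : 'rV[R]_k) : 0 < a ->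
  dilate a (@euclidean_ball R k) x <-> euclidean_norm x <= a.
Proof.
move=> a0; split=> [[y y1 <-]|xa].
  by rewrite euclidean_normZ gtr0_norm// ler_piMr// ltW.
exists (a^-1 *: x); last by rewrite scalerA mulfV ?gt_eqF// scale1r.
by rewrite /euclidean_ball/= euclidean_normZ gtr0_norm ?invr_gt0// mulrC ler_pdivrMr// mul1r.
Qed.

Let continuous_addr : continuous (fun x : R * R => x.1 + x.2).
Proof. by move=> x; apply: cvgD; [exact: cvg_fst | exact: cvg_snd]. Qed.

Lemma continuous_dot k (u : 'rV[R]_k) : continuous (dot u).
Proof.
have h := @continuous_big R 'I_k +%R 0 xpredT continuous_addr 'rV[R]_k
  (index_enum _) (fun i (v : 'rV[R]_k) => u 0 i * v 0 i).
apply: h => i _ x.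
apply: (@cvgMl_tmp _ _ (nbhs x) _ (fun v : 'rV[R]_k => v 0 i)).
exact: coord_continuous.
Qed.

Lemma continuous_dotxx k : continuous (fun x : 'rV[R]_k => dot x x).
Proof.
have h := @continuous_big R 'I_k +%R 0 xpredT continuous_addr 'rV[R]_k
  (index_enum _) (fun i (v : 'rV[R]_k) => v 0 i * v 0 i).
apply: h => i _ x.
apply: (@cvgM _ _ (nbhs x) _ (fun v : 'rV[R]_k => v 0 i) (fun v : 'rV[R]_k => v 0 i));
  exact: coord_continuous.
Qed.

End euclidean_structure.

(** * Separation and comparison of bodies through support functions *)

Section support_functions.
Context {R : realType} (k : nat).
Implicit Types (K : set 'rV[R]_k) (u x y : 'rV[R]_k).

Lemma support_function_ge K u y : compact K -> K y -> dot u y <= support_function K u.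
Proof.
move=> cK Ky; have K0 : K !=set0 by exists y.
have [|c cK1 cmax] := EVT_max_rV K0 cK (f := dot u).
  by apply: continuous_subspaceT => z; exact: continuous_dot.
apply: ub_le_sup; last by exists y.
by exists (dot u c) => _ [z Kz <-]; apply: cmax; rewrite inE.
Qed.

Lemma support_function_le K u (M : R) : K !=set0 ->
  (forall y, K y -> dot u y <= M) -> support_function K u <= M.
Proof.
move=> [y Ky] KM; apply: ge_sup; first by exists (dot u y), y.
by move=> _ [z Kz <-]; exact: KM.
Qed.

(** Separation by the nearest point [p] of [K] to [x]: minimality makes [p] maximize the linear form
    of direction [x - p] on [K], and unless [p = x] the value of this form at [x] is strictly
    larger. *)
Lemma mem_support_function K x : K !=set0 -> compact K -> convex_set K ->
  (forall u, dot u x <= support_function K u) -> K x.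
Proof.
move=> K0 cK convK xK.
have [|p pK pmin] := EVT_min_rV K0 cK (f := fun y => dot (y - x) (y - x)).
  apply: continuous_subspaceT => z.
  have cB : {for z, continuous (fun y : 'rV[R]_k => y - x)}.
    by apply: (@continuousB _ _ _ id (cst x)); [exact: cvg_id | exact: cst_continuous].
  exact: (@continuous_comp _ _ _ _ (fun y : 'rV[R]_k => dot y y) z cB (@continuous_dotxx R k _)).
have [/eqP|px] := eqVneq (dot (p - x) (p - x)) 0.
  by rewrite dot_eq0 subr_eq0 => /eqP <-; rewrite inE in pK.
have px0 : 0 < dot (p - x) (p - x) by rewrite lt_neqAle eq_sym px dot_ge0.
suff : support_function K (x - p) <= dot (x - p) p.
  move/(le_trans (xK (x - p))); rewrite -subr_le0 -dotNr -dotDr.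
  by rewrite -opprB dotNl dotNr dotDl -!dotDl opprK leNgt px0.
apply: support_function_le => // y Ky.
rewrite -subr_le0 -dotNr -dotDr -(opprB p x) dotNl oppr_le0 leNgt; apply/negP => yp.
set c := dot (p - x) (y - p) in yp; pose q := dot (y - p) (y - p).
have q0 : 0 <= q by exact: dot_ge0.
have qc : 0 < q - c by rewrite subr_gt0 (lt_le_trans yp).
(* Moving from [p] towards [y] by a fraction [l] changes the squared distance to [x] by l (2 c + l
   q). With this [l] one has l q <= - c, so the change is negative when c < 0; the denominator
   [q - c], instead of the optimal [q], keeps [l] at most 1. *)
have l0 : 0 <= - c / (q - c) by rewrite divr_ge0 ?oppr_ge0 ?ltW.
have l1 : - c / (q - c) <= 1 by rewrite ler_pdivrMr// mul1r lerDr.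
pose l : {i01 R} := Itv01 l0 l1.
have := pmin _ (convK y p l (mem_set Ky) pK).
rewrite [conv _ _ _](_ : _ = p + (- c / (q - c)) *: (y - p)); last first.
  by rewrite /conv/= /unstable.onem scalerBl scale1r scalerBr addrCA.
rewrite addrAC.
move: (p - x) (y - p) @c @q yp q0 qc {l l0 l1} => v w /= c0 q0 qc.
rewrite !dotE (dotC w v) -!addrA lerDl.
move: (dot v w) (dot w w) c0 q0 qc => c q c0 q0 qc.
set l := - c / (q - c).
have l0 : 0 < l by rewrite divr_gt0// oppr_gt0.
have lq : l * q <= - c.
  have qqc : q / (q - c) <= 1 by rewrite ler_pdivrMr// mul1r lerDl oppr_ge0 ltW.
  by rewrite /l -mulrA [_^-1 * q]mulrC ler_piMr// oppr_ge0 ltW.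
rewrite leNgt => /negP; apply.
rewrite (_ : _ + _ = l * (2 * c + l * q)); last by ring.
rewrite pmulr_rlt0//; lra.
Qed.

(** The support function of the image of [K] under [T] at [u] is that of [K] at [u *m T^T], so
    inclusions between bodies become inequalities. *)
Lemma support_between_balls K (T : 'M[R]_k) (a : R) u :
  compact K -> 0 < a ->
  @euclidean_ball R k `<=` linear_image T K ->
  linear_image T K `<=` dilate a (@euclidean_ball R k) ->
  euclidean_norm u <= support_function K (u *m T^T) <= a * euclidean_norm u.
Proof.
move=> cK a0 BK KB; apply/andP; split; last first.
  have [y Ky _] : linear_image T K 0.
    by apply: BK; rewrite /euclidean_ball/= -(scale0r 0) euclidean_normZ normr0 mul0r.
  apply: support_function_le => [|z Kz]; first by exists y.
  rewrite -dot_mulmx (le_trans (dot_le_norm _ _))// mulrC ler_wpM2r ?euclidean_norm_ge0//.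
  by apply/dilate_ballE => //; apply: KB; exists z.
have [u0|u0] := eqVneq (euclidean_norm u) 0.
  have [y Ky _] : linear_image T K 0.
    by apply: BK; rewrite /euclidean_ball/= -(scale0r 0) euclidean_normZ normr0 mul0r.
  have uz : u = 0 by apply/eqP; rewrite -euclidean_norm_eq0 u0.
  rewrite u0 uz mul0mx; have := support_function_ge 0 cK Ky.
  by rewrite -{1}(scale0r 0) dotZl mul0r.
(* The normalized vector lies in the ball, hence is the image of some [y] in [K], and this [y]
   witnesses the lower bound. *)
have [y Ky yE] : linear_image T K ((euclidean_norm u)^-1 *: u).
  apply: BK; rewrite /euclidean_ball/= euclidean_normZ.
  by rewrite ger0_norm ?invr_ge0 ?euclidean_norm_ge0// mulVf.
have := support_function_ge (u *m T^T) cK Ky.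
by rewrite -dot_mulmx yE dotZr -sqr_euclidean_norm expr2 mulrA mulVf// mul1r.
Qed.

(* The inner product norm squeezed between h_K / a and h_K satisfies the
   parallelogram law exactly. *)
Lemma distance_to_ball_parallelogram K (T : 'M[R]_k) (a : R) u v :
  compact K -> T \in unitmx -> 0 < a ->
  @euclidean_ball R k `<=` linear_image T K ->
  linear_image T K `<=` dilate a (@euclidean_ball R k) ->
  0 <= support_function K u -> 0 <= support_function K v ->
  2 * (support_function K u ^+ 2 + support_function K v ^+ 2) <=
  a ^+ 2 * (support_function K (u + v) ^+ 2 + support_function K (u - v) ^+ 2).
Proof.
move=> cK uT a0 BK KB u0 v0.
(* The inner product norm in question is q(w) = |w A|: since [A] undoes [T^T], the previous lemma
   reads q <= h_K <= a q. *)
pose A := invmx T^T.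
have AK w : w *m A *m T^T = w by rewrite mulmxKV// unitmx_tr.
have hA w := support_between_balls (w *m A) cK a0 BK KB.
have up w : 0 <= support_function K w ->
    support_function K w ^+ 2 <= a ^+ 2 * euclidean_norm (w *m A) ^+ 2.
  move=> w0; have /andP[_] := hA w; rewrite AK -exprMn => wa.
  by rewrite ler_sqr ?nnegrE// mulr_ge0 ?euclidean_norm_ge0// ltW.
have lo w : euclidean_norm (w *m A) ^+ 2 <= support_function K w ^+ 2.
  have /andP[+ _] := hA w; rewrite AK => wa.
  by rewrite ler_sqr ?nnegrE ?euclidean_norm_ge0// (le_trans (euclidean_norm_ge0 _) wa).
have := parallelogram (u *m A) (v *m A); rewrite -mulmxDl -mulmxBl => pE.
have := lerD (lo (u + v)) (lo (u - v)); rewrite pE => h.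
apply: le_trans (ler_wpM2l (sqr_ge0 a) h).
by rewrite mulrCA ler_pM2l// mulrDr lerD ?up.
Qed.

Lemma banach_mazur_attained (K L : set 'rV[R]_k) (c : R) (T : 'M[R]_k) :
  1 <= c -> T \in unitmx -> L `<=` linear_image T K ->
  linear_image T K `<=` dilate c L ->
  (forall a S, 1 <= a -> S \in unitmx -> L `<=` linear_image S K ->
    linear_image S K `<=` dilate a L -> c <= a) ->
  banach_mazur K L = c.
Proof.
move=> c1 uT LK KL cmin; apply/eqP; rewrite eq_le; apply/andP; split.
  apply: ge_inf; last by split=> //; exists T.
  by exists 1 => a [].
apply: lb_le_inf; first by exists c; split=> //; exists T.
by move=> a [a1 [S uS [LS SL]]]; exact: (cmin a S).
Qed.

(** The inner ball lies in [K] by Cauchy-Schwarz and separation. For the outer one, pairing a point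
    [x] of [K] with itself gives |x|^2 <= h_K(x) <= |x|. *)
Lemma body_between_balls K (b : R) : 0 < b -> b <= 1 ->
  convex_body K ->
  (forall u, b * euclidean_norm u <= support_function K u <= euclidean_norm u) ->
  dilate b (@euclidean_ball R k) `<=` K /\ K `<=` @euclidean_ball R k.
Proof.
move=> b0 b1 [cK convK _ [x0 /interior_subset Kx0]] hK; split=> x.
  move=> /(dilate_ballE _ b0) xb.
  apply: mem_support_function => //; first by exists x0.
  move=> u; have /andP[+ _] := hK u; apply: le_trans.
  by rewrite (le_trans (dot_le_norm _ _))// mulrC ler_wpM2r ?euclidean_norm_ge0.
move=> Kx; rewrite /euclidean_ball/=.
have /andP[_ hx] := hK x.
have := le_trans (support_function_ge x cK Kx) hx.
rewrite -sqr_euclidean_norm.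
have := euclidean_norm_ge0 x; move: (euclidean_norm x) => e; nra.
Qed.

End support_functions.

(** * Gaussian integrals *)

Section centered_gaussian_density.
Context {R : realType}.
Implicit Types x y t : R.
Notation mu := (@lebesgue_measure R).
Variable c : R.
Hypothesis c_gt0 : 0 < c.

(* Density of the centered Gaussian law of variance c^2 / 2. *)
Definition gauss_density x := (c * Num.sqrt pi)^-1 * expR (- (x / c) ^+ 2).

Let sqrt_pi := @sqrt_pi_gt0 R.

Lemma gauss_density_ge0 x : 0 <= gauss_density x.
Proof. by rewrite mulr_ge0 ?expR_ge0// invr_ge0 mulr_ge0// ltW. Qed.

Lemma gauss_densityN x : gauss_density (- x) = gauss_density x.
Proof. by rewrite /gauss_density mulNr sqrrN. Qed.

Lemma is_derive_gauss_density x :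
  is_derive x 1 gauss_density (- (2 / c ^+ 2) * x * gauss_density x).
Proof.
rewrite /gauss_density.
have d := is_derive_expR_sqr (c ^+ 2) x.
rewrite (_ : (fun y => _) =
    (fun y => (c * Num.sqrt pi)^-1 *: expR (- (y ^+ 2 / c ^+ 2)))); last first.
  by apply/funext => y; rewrite expr_div_n.
apply: is_derive_eq; rewrite /GRing.scale/= expr_div_n.
by move: (expR _) => e; field; rewrite !gt_eqF.
Qed.

Lemma is_derive_erf_density x :
  is_derive x 1 (fun y => erf (y / c)) (2 * gauss_density x).
Proof.
apply: (is_derive_eq (is_derive_erf_scale c x)).
rewrite /gauss_density; move: (expR _) => e; field.
by rewrite !gt_eqF.
Qed.

Lemma continuous_gauss_density : continuous gauss_density.
Proof. exact: is_derive_continuous is_derive_gauss_density. Qed.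

Let cvg_scale : (x / c : R) @[x --> +oo] --> +oo.
Proof.
by apply: (gt0_cvgMly (f := id)); [rewrite invr_gt0|exact: cvg_id].
Qed.

Lemma cvg_gauss_densityy : gauss_density x @[x --> +oo] --> (0 : R).
Proof.
rewrite /gauss_density -[X in _ --> X](mulr0 (c * Num.sqrt pi)^-1).
apply: cvgMl_tmp.
exact: (cvg_comp (fun x => x / c) gauss_fun cvg_scale cvg_gauss_fun).
Qed.

Lemma cvg_mul_gauss_densityy : (x * gauss_density x : R) @[x --> +oo] --> (0 : R).
Proof.
have h : ((Num.sqrt pi)^-1 * expR (- (x / c)) : R) @[x --> +oo] --> (0 : R).
  rewrite -[X in _ --> X](mulr0 (Num.sqrt pi)^-1); apply: cvgMl_tmp.
  exact: (cvg_comp (fun x => x / c) (fun x => expR (- x)) cvg_scale (@cvgr_expR R)).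
apply: (@squeeze_cvgr _ _ _ _ (cst 0) (fun x => (Num.sqrt pi)^-1 * expR (- (x / c))));
  [|exact: cvg_cst|exact: h].
near=> x.
(* For u = x / c >= 2 one has u <= e^u and u - u^2 <= - u, hence u exp(-u^2) <= exp(-u). *)
have x2 : 2 * c <= x by near: x; apply: nbhs_pinfty_ge; exact: num_real.
have x0 : 0 <= x by rewrite (le_trans _ x2)// mulr_ge0// ltW.
rewrite mulr_ge0 ?gauss_density_ge0//=.
rewrite (_ : x * _ = (Num.sqrt pi)^-1 * ((x / c) * expR (- (x / c) ^+ 2))); last first.
  by rewrite /gauss_density; move: (expR _) => e; field; rewrite !gt_eqF.
rewrite ler_pM2l ?invr_gt0//.
have u2 : 2 <= x / c by rewrite ler_pdivlMr.
move: (x / c) u2 => u u2.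
rewrite (@le_trans _ _ (expR u * expR (- u ^+ 2)))//.
  by rewrite ler_wpM2r ?expR_ge0// (le_trans _ (expR_ge1Dx u))// lerDr.
rewrite -expRD ler_expR; nra.
Unshelve. all: by end_near. Qed.

Let FTC (f F : R -> R) (a l : R) :
  (forall x, a <= x -> 0 <= f x) -> continuous f ->
  (forall x : R, is_derive x 1 F (f x)) ->
  F x @[x --> +oo] --> l ->
  (\int[mu]_(x in `[a, +oo[) (f x)%:E = (l - F a)%:E)%E.
Proof.
move=> f0 cf dF Fl; rewrite EFinB; apply: ge0_continuous_FTC2y => //.
- exact: continuous_subspaceT.
- by apply: cvg_at_right_filter; exact: (is_derive_continuous dF).
- by move=> x _; rewrite derive1E (@derive_val _ _ _ _ _ _ _ (dF x)).
Qed.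

Lemma integral_half_shift_gauss t :
  (\int[mu]_(x in `[(- t)%R, +oo[) ((x + t) * gauss_density x)%R%:E =
   (t / 2 + c ^+ 2 / 2 * gauss_density t + t / 2 * erf (t / c))%R%:E)%E.
Proof.
(* An explicit antiderivative, read off from g' = -(2 / c^2) x g and from [erf (x / c)] having
   derivative 2 g. *)
pose F x := - (c ^+ 2 / 2) * gauss_density x + t / 2 * erf (x / c).
have f0 x : - t <= x -> 0 <= (x + t) * gauss_density x.
  by move=> tx; rewrite mulr_ge0 ?gauss_density_ge0// -(opprK t) subr_ge0.
have cf : continuous (fun x => (x + t) * gauss_density x).
  move=> x; apply: (@cvgM _ _ (nbhs x) _ (fun y => y + t) gauss_density).
    by apply: (@cvgD _ _ _ (nbhs x) _ id (cst t)); [exact: cvg_id|exact: cvg_cst].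
  exact: continuous_gauss_density.
have dF x : is_derive x 1 F ((x + t) * gauss_density x).
  have d1 := is_derive_gauss_density x; have d2 := is_derive_erf_density x.
  rewrite (_ : F = (fun y => (- (c ^+ 2 / 2)) *: (gauss_density y) + (t / 2) *: erf (y / c)))//.
  apply: is_derive_eq; rewrite /GRing.scale/=.
  by move: (gauss_density x) => e; field; rewrite gt_eqF.
have Fl : F x @[x --> +oo] --> t / 2.
  rewrite -[X in _ --> X](_ : - (c ^+ 2 / 2) * 0 + t / 2 * 1 = _);
    last by rewrite mulr0 add0r mulr1.
  apply: cvgD; apply: cvgMl_tmp; first exact: cvg_gauss_densityy.
  exact: (cvg_comp (fun x => x / c) (@erf R) cvg_scale (@cvg_erfy R)).
apply: etrans (FTC f0 cf dF Fl) _.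
by congr EFin; rewrite /F gauss_densityN (mulNr t) erfN; ring.
Qed.

Lemma integral_half_sqr_gauss :
  (\int[mu]_(x in `[0%R, +oo[) (x ^+ 2 * gauss_density x)%R%:E = (c ^+ 2 / 4)%R%:E)%E.
Proof.
(* Integration by parts of x times x g, the factor x g being - c^2 / 2 times the derivative of g. *)
pose F x := - (c ^+ 2 / 2) * (x * gauss_density x) + c ^+ 2 / 4 * erf (x / c).
have f0 x : 0 <= x -> 0 <= x ^+ 2 * gauss_density x.
  by move=> tx; rewrite mulr_ge0 ?gauss_density_ge0// sqr_ge0.
have cf : continuous (fun x => x ^+ 2 * gauss_density x).
  move=> x; apply: (@cvgM _ _ (nbhs x) _ (fun y => y ^+ 2) gauss_density).
    exact: exprn_continuous.
  exact: continuous_gauss_density.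
have dF x : is_derive x 1 F (x ^+ 2 * gauss_density x).
  have d1 := is_derive_gauss_density x; have d2 := is_derive_erf_density x.
  rewrite (_ : F = (fun y => (- (c ^+ 2 / 2)) *: (y * gauss_density y : R) +
    (c ^+ 2 / 4) *: erf (y / c)))//.
  apply: is_derive_eq; rewrite /GRing.scale/=.
  by move: (gauss_density x) => e; field; rewrite gt_eqF.
have Fl : F x @[x --> +oo] --> c ^+ 2 / 4.
  rewrite -[X in _ --> X](_ : - (c ^+ 2 / 2) * 0 + c ^+ 2 / 4 * 1 = _);
    last by rewrite mulr0 add0r mulr1.
  apply: cvgD; apply: cvgMl_tmp; first exact: cvg_mul_gauss_densityy.
  exact: (cvg_comp (fun x => x / c) (@erf R) cvg_scale (@cvg_erfy R)).
apply: etrans (FTC f0 cf dF Fl) _.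
by congr EFin; rewrite /F !mul0r erf0 !mulr0 addr0 subr0.
Qed.

End centered_gaussian_density.

(** * Integration against a measure given by a density *)

Section integral_density.
Local Open Scope ereal_scope.
Context d (T : measurableType d) (R : realType).
Variables (mu nu : {measure set T -> \bar R}) (p : T -> R).
Hypotheses (mp : measurable_fun setT p) (p0 : forall x, (0 <= p x)%R).
Hypothesis nuE : forall A, measurable A -> nu A = \int[mu]_(x in A) (p x)%:E.

Import HBNNSimple.

Let nnsfun_density (h : {nnsfun T >-> R}) :
  \int[nu]_x (h x)%:E = \int[mu]_x ((h x)%:E * (p x)%:E).
Proof.
under [LHS]eq_integral do rewrite fimfunE -fsumEFin//.
rewrite [LHS]ge0_integral_fsum//; last 2 first.
  - by move=> r; exact/measurable_EFinP/measurableT_comp.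
  - by move=> n x _; rewrite EFinM nnfun_muleindic_ge0.
under [RHS]eq_integral.
  move=> x xD; rewrite fimfunE -fsumEFin// muleC ge0_mule_fsumr; last first.
    by move=> r; rewrite EFinM nnfun_muleindic_ge0.
  over.
have mi r : measurable_fun setT (fun x => (p x)%:E * (\1_(h @^-1` [set r]) x)%:E).
  apply: emeasurable_funM; first exact/measurable_EFinP.
  by apply/measurable_EFinP; exact: measurable_indic.
rewrite [RHS]ge0_integral_fsum//; last 2 first.
  - move=> r; apply: emeasurable_funM; first exact/measurable_EFinP.
    by apply/measurable_EFinP; exact/measurableT_comp.
  - move=> r x _; apply: mule_ge0; first by rewrite lee_fin.
    by rewrite EFinM nnfun_muleindic_ge0.
apply: eq_fsbigr => r _.
rewrite integralZl_indic_nnsfun// integral_indic// setIT nuE//.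
have [r0|r0] := ltP r 0%R.
  rewrite preimage_nnfun0// integral_set0 mule0.
  by rewrite integral0_eq// => x _; rewrite indic0 mulr0 mule0.
under [RHS]eq_integral do rewrite EFinM muleCA.
rewrite ge0_integralZl_EFin//; last first.
  by move=> x _; rewrite mule_ge0 ?lee_fin.
congr (_ * _); rewrite integral_mkcond; apply: eq_integral => x _.
by rewrite patchE indicE; case: ifPn => _; rewrite ?mule1 ?mule0.
Qed.

(** The identity for simple functions passes to the limit by monotone convergence, applied once to
    [nu] and once to [mu]. *)
Lemma ge0_integral_density (f : T -> \bar R) : measurable_fun setT f ->
  (forall x, 0 <= f x) -> \int[nu]_x f x = \int[mu]_x (f x * (p x)%:E).
Proof.
move=> mf f0; pose f_ := nnsfun_approx measurableT mf.
have nd x m n : (m <= n)%N -> (f_ m x <= f_ n x)%R.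
  by move=> mn; exact/lefP/nd_nnsfun_approx.
transitivity (lim (\int[nu]_x (f_ n x)%:E @[n --> \oo])).
  rewrite -monotone_convergence//=.
  - apply: eq_integral => ? /[!inE] xD; apply/esym/cvg_lim => //=.
    exact: cvg_nnsfun_approx.
  - by move=> n; exact/measurable_EFinP/measurable_funTS.
  - by move=> n ? _; rewrite lee_fin.
  - by move=> x _ m n mn; rewrite lee_fin nd.
transitivity (lim (\int[mu]_x ((f_ n x)%:E * (p x)%:E) @[n --> \oo])).
  by apply: congr_lim; apply/funext => n /=; exact: nnsfun_density.
rewrite -monotone_convergence//=.
- apply: eq_integral => x _; apply/cvg_lim => //.
  apply: cvgeZr => //.
  exact: cvg_nnsfun_approx.
- move=> n; apply: emeasurable_funM; last exact/measurable_EFinP.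
  exact/measurable_EFinP/measurable_funTS.
- by move=> n x _; rewrite mule_ge0 ?lee_fin.
- by move=> x _ m n mn; rewrite lee_wpmul2r ?lee_fin// nd.
Qed.

End integral_density.

(** * Absolute and second moments of the Gaussian density *)

Section gaussian_integrals.
Context {R : realType}.
Notation mu := (@lebesgue_measure R).

Lemma ge0_integral_oppr (f : R -> \bar R) : measurable_fun setT f ->
  (forall x, (0 <= f x)%E) -> (\int[mu]_x f (- x)%R = \int[mu]_x f x)%E.
Proof.
move=> mf f0.
have <- : (\int[pushforward mu (-%R : R -> measurableTypeR R)]_x f x = \int[mu]_x f x)%E.
  by apply: eq_measure_integral => //= A mA _; exact: lebesgue_measureN.
by rewrite ge0_integral_pushforward.
Qed.

Variable c : R.
Hypothesis c_gt0 : 0 < c.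
Notation g := (gauss_density c).

Let mg : measurable_fun [set: R] g.
Proof. by apply: continuous_measurable_fun; exact: continuous_gauss_density. Qed.

Let integral_pos_shift (t : R) :
  (\int[mu]_x (Num.max (x + t) 0 * g x)%R%:E =
   (t / 2 + c ^+ 2 / 2 * g t + t / 2 * erf (t / c))%R%:E)%E.
Proof.
rewrite -integral_half_shift_gauss// [RHS]integral_mkcond.
apply: eq_integral => x _; rewrite patchE.
case: ifPn => [|]; rewrite ?notin_setE ?inE/= in_itv/= andbT.
  by rewrite -subr_ge0 opprK => /max_l ->.
move/negP; rewrite -ltNge => /ltW; rewrite -subr_le0 opprK => /max_r ->.
by rewrite mul0r.
Qed.

Let mpos (t : R) : measurable_fun setT (fun x : R => (Num.max (x + t) 0 * g x)%:E).
Proof.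
apply/measurable_EFinP; apply: measurable_funM => //.
by apply: measurable_maxr => //; exact: measurable_funD.
Qed.

Let pos_ge0 (t x : R) : (0 <= (Num.max (x + t) 0 * g x)%:E)%E.
Proof. by rewrite lee_fin mulr_ge0 ?gauss_density_ge0// le_max lexx orbT. Qed.

Lemma integral_abs_shift_gauss (t : R) :
  (\int[mu]_x (`|x + t| * g x)%R%:E = (c ^+ 2 * g t + t * erf (t / c))%R%:E)%E.
Proof.
(* The absolute value is split into positive and negative parts; by evenness of [g], the reflection
   of x turns the negative part into the positive part for the shift [- t]. *)
transitivity (\int[mu]_x ((Num.max (x + t) 0 * g x)%R%:E +
    (Num.max (- x + - t) 0 * g (- x))%R%:E))%E.
  apply: eq_integral => x _; rewrite -EFinD gauss_densityN -mulrDl -opprD.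
  congr (_ * _)%:E; case: (leP 0 (x + t)) => xt.
    by rewrite ger0_norm// max_r ?addr0// oppr_le0.
  by rewrite ltr0_norm// add0r max_l// oppr_ge0 ltW.
have mN : measurable_fun setT (fun x : R => - x).
  by apply: continuous_measurable_fun => x; apply: cvgN; exact: cvg_id.
have mposN := measurableT_comp (mpos (- t)) mN.
rewrite (ge0_integralD mu measurableT (fun x _ => pos_ge0 t x) (mpos t)
  (fun x _ => pos_ge0 (- t) (- x)) mposN).
rewrite (@ge0_integral_oppr (fun x => (Num.max (x + - t) 0 * g x)%R%:E))//.
rewrite !integral_pos_shift -EFinD; congr EFin.
by rewrite gauss_densityN !mulNr erfN; lra.
Qed.

Lemma integral_sqr_gauss :
  (\int[mu]_x (x ^+ 2 * g x)%R%:E = (c ^+ 2 / 2)%R%:E)%E.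
Proof.
rewrite ge0_symfun_integralT.
- rewrite -set_itvcy integral_half_sqr_gauss// -EFinM; congr EFin; lra.
- by move=> x; rewrite mulr_ge0 ?sqr_ge0 ?gauss_density_ge0.
- move=> x; apply: (@cvgM _ _ (nbhs x) _ (fun y => y ^+ 2) g).
    exact: exprn_continuous.
  exact: continuous_gauss_density.
- by move=> x /=; rewrite sqrrN gauss_densityN.
Qed.

End gaussian_integrals.

(** Matching the variances s^2 = c^2 / 2 gives the scale c = s sqrt 2. *)
Lemma normal_pdf_shift (R : realType) (m s x : R) : 0 < s ->
  normal_pdf m s (x + m) = gauss_density (s * Num.sqrt 2) x.
Proof.
move=> s0; rewrite normal_pdfE ?gt_eqF// /normal_fun /gauss_density addrK; congr (_ * expR _).
  rewrite /normal_peak; congr (_^-1).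
  rewrite -mulrnAr -[in LHS]mulr_natr sqrtrM ?sqr_ge0// sqrtr_sqr gtr0_norm//.
  by rewrite mulrC (mulrC pi) sqrtrM// -mulrA mulrC.
by rewrite expr_div_n exprMn sqr_sqrtr// mulr_natr mulNr.
Qed.

(** * Expectations under a Gaussian law *)

Section gaussian_law_expectation.
Context d (Omega : measurableType d) (R : realType) (P : probability Omega R).
Notation mu := (@lebesgue_measure R).
Implicit Types (X : {RV P >-> R}) (f : R -> R).

(** The alternatives are the Dirac mass and a law with density. Nonnegative test functions spare any
    integrability condition, and [m] is so far only a parameter of the law. *)
Lemma gaussian_law_expectation X : gaussian_law (pushforward P X) ->
  exists m : R,
    (forall f, continuous f -> (forall x, 0 <= f x) ->
      ('E_P[f \o X] = (f m)%:E)%E) \/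
    exists2 c : R, 0 < c &
    forall f, continuous f -> (forall x, 0 <= f x) ->
      ('E_P[f \o X] = \int[mu]_x (f (x + m)%R * gauss_density c x)%R%:E)%E.
Proof.
move=> [m [s [s0 lawX]]]; exists m.
have mX : measurable_fun setT (X : Omega -> measurableTypeR R).
  exact: (@measurable_funPT _ _ _ _ X).
pose Y : {RV P >-> measurableTypeR R} := HB.pack (X : Omega -> measurableTypeR R)
  (isMeasurableFun.Build _ _ _ _ _ mX).
(* [Y] is [X] retyped to the measurable space on which Lebesgue measure is defined, so that its
   distribution can be compared with [normal_prob]. *)
have lawY A : measurable A ->
  distribution P Y A = if s == 0 then \d_m A else normal_prob m s A by exact: lawX.
have EX f : continuous f -> (forall x, 0 <= f x) ->
    ('E_P[f \o X] = \int[distribution P Y]_y (f y)%:E)%E.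
  move=> cf f0; rewrite ge0_integral_distribution ?unlock//.
  by apply/measurable_EFinP; exact: continuous_measurable_fun.
move: s0; rewrite le_eqVlt => /predU1P[s0|s0]; [left|right].
  move=> f cf f0; rewrite EX//.
  rewrite (@eq_measure_integral _ (measurableTypeR R) _ _
    (dirac (m : measurableTypeR R))); last first.
    by move=> A mA _; have := lawY A mA; rewrite -s0 eqxx.
  rewrite integral_dirac//; first by rewrite diracT mul1e.
  by apply/measurable_EFinP; exact: continuous_measurable_fun.
exists (s * Num.sqrt 2); first by rewrite mulr_gt0// sqrtr_gt0.
move=> f cf f0; rewrite EX//.
have cp : continuous (normal_pdf m s) by apply: continuous_normal_pdf; rewrite gt_eqF.
have lawA A : measurable A ->
    distribution P Y A = (\int[mu]_(x in A) (normal_pdf m s x)%:E)%E.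
  by move=> mA; have := lawY A mA; rewrite gt_eqF.
have mf : measurable_fun setT (EFin \o f).
  by apply/measurable_EFinP; exact: continuous_measurable_fun.
have f0' x : (0 <= (EFin \o f) x)%E by rewrite lee_fin.
rewrite (@ge0_integral_density _ (measurableTypeR R) R mu (distribution P Y) _
  (measurable_normal_pdf m s) (normal_pdf_ge0 m s) lawA _ mf f0').
under eq_integral do rewrite -EFinM.
have dF (x : R) : is_derive x 1 (fun x : R => x + m) 1.
  by apply: is_derive_eq; rewrite addr0.
have F' : (fun x : R => x + m)^`()%classic = cst 1.
  by apply/funext => x; rewrite derive1E (@derive_val _ _ _ _ _ _ _ (dF x)).
(* The translation by [m] centers the density. *)
rewrite (@increasing_ge0_integration_by_substitutionT _ (fun x => x + m)
  (fun y => f y * normal_pdf m s y)).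
- apply: eq_integral => x _; rewrite F'; congr EFin.
  by rewrite /GRing.mul/= /cst/= -(normal_pdf_shift m)//; exact: mulr1.
- by move=> x y xy; rewrite ltrD2r.
- by rewrite F'; exact: cst_continuous.
- by rewrite F'; exact: is_cvg_cst.
- by rewrite F'; exact: is_cvg_cst.
- by move=> x; have [] := dF x.
- exact: cvg_addrr_Ny.
- exact: cvg_addrr.
- move=> x; apply: (@cvgM _ _ (nbhs x) _ f (normal_pdf m s)); [exact: cf|exact: cp].
- by move=> x; rewrite mulr_ge0// normal_pdf_ge0.
Qed.

End gaussian_law_expectation.

Section gaussian_abs_moment.
Context d (Omega : measurableType d) (R : realType) (P : probability Omega R).
Notation mu := (@lebesgue_measure R).
Implicit Types (X : {RV P >-> R}) (f : R -> R).

Let continuous_sqr_shift (m : R) : continuous (fun x : R => (m - x) ^+ 2).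
Proof.
move=> x; apply: (@cvg_comp _ _ _ (fun x => m - x) (fun x => x ^+ 2) _ (nbhs (m - x))).
  by apply: (@cvgB _ _ _ (nbhs x) _ (cst m) id); [exact: cvg_cst|exact: cvg_id].
exact: exprn_continuous.
Qed.

Lemma expectation_sqr_shift X (m : R) :
  P.-integrable setT (EFin \o X) ->
  P.-integrable setT (EFin \o (fun w => X w ^+ 2)) ->
  ('E_P[X] = 0)%E ->
  ('E_P[(fun x : R => ((m - x) ^+ 2)%R) \o X] = (m ^+ 2)%R%:E + 'E_P[fun w => (X w ^+ 2)%R])%E.
Proof.
move=> /Lfun1_integrable iX /Lfun1_integrable iX2 X0.
rewrite (_ : _ \o X = cst (m ^+ 2) \+ (((- (2 * m)) \o* X) \+ (fun w => X w ^+ 2))); last first.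
  by apply/funext => w /=; ring.
have i1 : (- (2 * m)) \o* X \in Lfun P 1.
  apply/Lfun1_integrable; rewrite (_ : _ \o _ = (fun w => (- (2 * m))%:E * (X w)%:E)%E); last first.
    by apply/funext => w /=; rewrite EFinM muleC.
  by apply: integrableZl => //; exact/Lfun1_integrable.
have i2 : ((- (2 * m)) \o* X) \+ (fun w => X w ^+ 2) \in Lfun P 1.
  apply/Lfun1_integrable; rewrite (_ : _ \o _ =
    (fun w => ((EFin \o (- (2 * m) \o* X)) w + (EFin \o (fun w => (X w ^+ 2)%R)) w)%E)).
    by apply: integrableD => //; exact/Lfun1_integrable.
  by apply/funext => w.
rewrite expectationD ?Lfun_cst// expectationD// (@expectationZl _ _ _ P X)// X0 mule0 add0e.
by rewrite expectation_cst.
Qed.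

(** The first two moments determine the law: the center is 0, and the second moment c^2 / 2 = (pi /
    2) r^2 forces c = r sqrt pi. The Dirac mass corresponds exactly to r = 0. *)
Lemma gaussian_abs_shift X (r : R) (t : R) : 0 <= r ->
  gaussian_law (pushforward P X) ->
  P.-integrable setT (EFin \o X) ->
  P.-integrable setT (EFin \o (fun w => X w ^+ 2)) ->
  ('E_P[X] = 0)%E -> ('E_P[fun w => (X w ^+ 2)%R] = (pi / 2 * r ^+ 2)%R%:E)%E ->
  ('E_P[fun w => (`|X w + t|)%R] = (if r == 0 then `|t| else r * profile (t / r))%R%:E)%E.
Proof.
move=> r0 /gaussian_law_expectation[m EX] iX iX2 X0 X2.
have c2 : continuous (fun x : R => x ^+ 2) by exact: exprn_continuous.
have cabs : continuous (fun x : R => `|x + t|).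
  move=> x; apply: (@cvg_norm _ _ _ (nbhs x) _ (fun x => x + t)).
  by apply: (@cvgD _ _ _ (nbhs x) _ id (cst t)); [exact: cvg_id|exact: cvg_cst].
have sq0 (x : R) : 0 <= x ^+ 2 by exact: sqr_ge0.
have sqm0 (a x : R) : 0 <= (a - x) ^+ 2 by exact: sqr_ge0.
(* The law is symmetric about m, so X and 2m - X have the same second moment,
   whereas E X = 0. *)
have m0 : m = 0.
  have cm : continuous (fun x : R => (x + m) ^+ 2).
    rewrite (_ : (fun x => _) = (fun x => (- m - x) ^+ 2)); last first.
      by apply/funext => z; ring.
    exact: continuous_sqr_shift.
  have : ('E_P[(fun x : R => ((2 * m - x) ^+ 2)%R) \o X] = 'E_P[(fun x : R => (x ^+ 2)%R) \o X])%E.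
    case: EX => [EX|[c c0 EX]].
      by rewrite !EX//; congr EFin; ring.
    rewrite !EX// -(@ge0_integral_oppr _ (fun x => ((x + m) ^+ 2 * gauss_density c x)%:E)).
    - apply: eq_integral => x _; rewrite gauss_densityN; congr (_ * _)%:E; ring.
    - apply/measurable_EFinP; apply: continuous_measurable_fun => x.
      apply: (@cvgM _ _ (nbhs x) _ (fun x => (x + m) ^+ 2) (gauss_density c)).
        exact: cm.
      exact: continuous_gauss_density.
    - by move=> x; rewrite lee_fin mulr_ge0// gauss_density_ge0.
  rewrite expectation_sqr_shift// X2 -EFinD => -[] /eqP.
  by rewrite -subr_eq0 addrK sqrf_eq0 mulf_eq0 pnatr_eq0/= => /eqP.
rewrite m0 in EX.
have pi0 := pi_gt0 R.
case: EX => [EX|[c c0 EX]].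
  have := EX _ c2 sq0; rewrite X2 expr0n/= => -[] /eqP.
  rewrite mulf_eq0 sqrf_eq0 gt_eqF ?divr_gt0//= => ->.
  by have := EX _ cabs (fun x => normr_ge0 _); rewrite add0r.
have := EX _ c2 sq0; rewrite X2.
under eq_integral do rewrite addr0.
rewrite integral_sqr_gauss// => -[] cr.
have cE : c = r * Num.sqrt pi.
  have rpi : 0 <= r * Num.sqrt pi by rewrite mulr_ge0// sqrtr_ge0.
  apply/eqP; rewrite -(@eqrXn2 _ 2 _ _ isT (ltW c0) rpi).
  rewrite exprMn sqr_sqrtr ?ltW//; apply/eqP; lra.
have rn0 : r != 0 by apply: contraTneq c0 => r_eq0; rewrite cE r_eq0 mul0r ltxx.
rewrite (negbTE rn0).
apply: etrans (EX _ cabs (fun x => normr_ge0 _)) _.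
under eq_integral do rewrite addr0.
rewrite integral_abs_shift_gauss//; congr EFin.
have sp := @sqrt_pi_gt0 R.
rewrite /gauss_density /profile cE.
have -> : (t / (r * Num.sqrt pi)) ^+ 2 = t ^+ 2 / r ^+ 2 / pi.
  by rewrite expr_div_n exprMn sqr_sqrtr ?ltW// invfM mulrA.
have -> : (t / r) ^+ 2 / pi = t ^+ 2 / r ^+ 2 / pi by rewrite expr_div_n.
have -> : t / r / Num.sqrt pi = t / (r * Num.sqrt pi) by rewrite invfM mulrA.
move: (expR _) (erf _) => e f.
by rewrite exprMn; field; rewrite rn0 gt_eqF.
Qed.

End gaussian_abs_moment.

(** * Moments of linear forms of a random vector *)

Section gaussian_vector.
Context d (Omega : measurableType d) (R : realType) (P : probability Omega R).
Variables (k : nat) (Gamma : 'I_k -> {RV P >-> R}).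

(** The index type is arbitrary because the lemma serves both for the coordinates and for pairs of
    coordinates. *)
Let lincomb_integrable (I : finType) (a : I -> R) (X : I -> Omega -> R) :
  (forall i, P.-integrable setT (EFin \o X i)) ->
  P.-integrable setT (EFin \o (fun w => \sum_i a i * X i w)) /\
  ('E_P[(fun w => \sum_i a i * X i w)%R] = \sum_i (a i)%:E * 'E_P[X i])%E.
Proof.
move=> iX.
have iaX i : P.-integrable setT (fun w => ((a i)%:E * (X i w)%:E)%E).
  by apply: integrableZl => //; exact: iX.
have sE : EFin \o (fun w => \sum_i a i * X i w) =
    (fun w => (\sum_i (a i)%:E * (X i w)%:E)%E).
  by apply/funext => w /=; rewrite -sumEFin.
split; first by rewrite sE; exact: integrable_sum.
rewrite unlock.
transitivity (\int[P]_w (\sum_i (a i)%:E * (X i w)%:E))%E.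
  by apply: eq_integral => w _; rewrite -sumEFin.
rewrite integral_sum//; apply: eq_bigr => i _.
by rewrite integralZl//; exact: iX.
Qed.

Hypothesis mean0 : forall i, ('E_P[Gamma i] = 0)%E.
Variable Sigma : 'M[R]_k.
Hypothesis cov : forall i j, covariance P (Gamma i) (Gamma j) = (Sigma i j)%:E.

(** Unfolding the covariance with zero means requires no integrability, which is only derived
    afterwards from this identity. *)
Let expectation_mul i j : ('E_P[fun w => (Gamma i w * Gamma j w)%R] = (Sigma i j)%:E)%E.
Proof.
rewrite -cov [in RHS]unlock !mean0/=; congr expectation.
by apply/funext => w /=; rewrite !fctE/= !subr0.
Qed.

(** A square is nonnegative, and its expectation is the real number [Sigma i i], hence finite. *)
Let integrable_sqr i : P.-integrable setT (EFin \o (fun w => Gamma i w * Gamma i w)).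
Proof.
have mGG : measurable_fun setT (fun w => Gamma i w * Gamma i w).
  by apply: measurable_funM.
apply/integrableP; split; first exact/measurable_EFinP.
have := expectation_mul i i; rewrite unlock => e.
rewrite (_ : integral _ _ _ = (Sigma i i)%:E) ?ltry// -e.
by apply: eq_integral => w _ /=; rewrite ger0_norm// -expr2 sqr_ge0.
Qed.

(** Domination by |x y| <= x^2 + y^2. *)
Let integrable_mul i j : P.-integrable setT (EFin \o (fun w => Gamma i w * Gamma j w)).
Proof.
have iD := integrableD measurableT (integrable_sqr i) (integrable_sqr j).
apply: le_integrable iD => //.
  by apply/measurable_EFinP; apply: measurable_funM.
move=> w _ /=; rewrite lee_fin.
set x := Gamma i w; set y := Gamma j w.
rewrite [leRHS]ger0_norm; last by rewrite addr_ge0// -expr2 sqr_ge0.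
rewrite ler_norml; apply/andP; split; nra.
Qed.

(** Domination by |x| <= 1 + x^2. *)
Let integrable_Gamma i : P.-integrable setT (EFin \o Gamma i).
Proof.
have i1 : P.-integrable setT (EFin \o cst (1 : R)).
  by apply/Lfun1_integrable; exact: Lfun_cst.
have iD := integrableD measurableT i1 (integrable_sqr i).
apply: le_integrable iD => //; first exact/measurable_EFinP.
move=> w _ /=; rewrite lee_fin; set x := Gamma i w.
rewrite [leRHS]ger0_norm; last by rewrite addr_ge0// -expr2 sqr_ge0.
rewrite ler_norml; apply/andP; split; nra.
Qed.

Lemma linear_form_moments (x : 'rV[R]_k) (Y := fun w => \sum_i x 0 i * Gamma i w) :
  [/\ P.-integrable setT (EFin \o Y),
      P.-integrable setT (EFin \o (fun w => Y w ^+ 2)),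
      ('E_P[Y] = 0)%E &
      ('E_P[fun w => (Y w ^+ 2)%R] =
        (\sum_i \sum_j x 0 i * x 0 j * Sigma i j)%R%:E)%E].
Proof.
have [iY EY] := lincomb_integrable (fun i => x 0 i) integrable_Gamma.
have [iY2 EY2] := lincomb_integrable (fun ij : 'I_k * 'I_k => x 0 ij.1 * x 0 ij.2)
  (fun ij => integrable_mul ij.1 ij.2).
have YE : (fun w => Y w ^+ 2) = (fun w => \sum_(ij : 'I_k * 'I_k)
    x 0 ij.1 * x 0 ij.2 * (Gamma ij.1 w * Gamma ij.2 w)).
  apply/funext => w; rewrite expr2 /Y big_distrlr/= pair_big/=.
  by apply: eq_bigr => ij _; rewrite mulrACA.
split=> //.
- by rewrite YE.
- by rewrite EY big1// => i _; rewrite mean0 mule0.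
- rewrite YE EY2 pair_big/= -sumEFin; apply: eq_bigr => ij _.
  by rewrite expectation_mul -EFinM.
Qed.

End gaussian_vector.

(** * The support function of the zonoid *)

Lemma profileN (R : realType) (s : R) : profile (- s) = profile s.
Proof. by rewrite /profile sqrrN (mulNr s (Num.sqrt pi)^-1) erfN mulrNN. Qed.

Section gaussian_zonoid.
Context (R : realType) (n : nat) (d : measure_display) (Omega : measurableType d).
Variables (P : probability Omega R) (Gamma : 'I_n -> {RV P >-> R}).
Hypothesis hGamma : centered_gaussian_vector Gamma (pi / 2)%:M.
Implicit Types (x : 'rV[R]_n) (t : R).

(** The linear form of direction [x] is a centered Gaussian variable with second moment (pi / 2)
    |x|^2, the case r = |x| of [gaussian_abs_shift]. *)
Lemma expectation_abs_gaussian_form x t :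
  ('E_P[fun w => (`|\sum_(i < n) x 0 i * Gamma i w + t|)%R] =
   (if euclidean_norm x == 0 then `|t|
    else euclidean_norm x * profile (t / euclidean_norm x))%R%:E)%E.
Proof.
have [law mean cov] := hGamma.
have [iY iY2 EY EY2] := linear_form_moments mean cov x.
have mY : measurable_fun setT (fun w => \sum_(i < n) x 0 i * Gamma i w).
  by have /integrableP[/measurable_EFinP] := iY.
pose Y : {RV P >-> R} := HB.pack (fun w => \sum_(i < n) x 0 i * Gamma i w)
  (isMeasurableFun.Build _ _ _ _ _ mY).
apply: (@gaussian_abs_shift _ _ _ P Y) => //.
- exact: euclidean_norm_ge0.
- exact: law.
- rewrite EY2; congr EFin.
  rewrite sqr_euclidean_norm mulr_sumr; apply: eq_bigr => i _.
  rewrite (bigD1 i)//= big1 ?addr0 => [|j ji]; first by rewrite mxE eqxx mulr1n mulrC.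
  by rewrite mxE eq_sym (negbTE ji) mulr0n mulr0.
Qed.

End gaussian_zonoid.

(** * Comparison with Euclidean balls and optimality *)

Lemma sqr_norm_row_mx (R : realType) (n : nat) (x : 'rV[R]_n) (t : R) :
  euclidean_norm (row_mx x t%:M : 'rV_(n + 1)) ^+ 2 = euclidean_norm x ^+ 2 + t ^+ 2.
Proof.
rewrite !sqr_euclidean_norm !dot_mx tr_row_mx mul_row_col mxE; congr (_ + _).
by rewrite tr_scalar_mx -scalar_mxM mxE eqxx mulr1n expr2.
Qed.

Theorem theorem5p3 (R : realType) (n : nat) (hn : (2 <= n)%N)
    (d : measure_display) (Omega : measurableType d) (P : probability Omega R)
    (Gamma : 'I_n.-1 -> {RV P >-> R})
    (hGamma : centered_gaussian_vector Gamma (pi / 2)%:M)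
    (Z : set 'rV[R]_(n.-1 + 1)) (hZ : convex_body Z)
    (hsupp : forall (x : 'rV[R]_n.-1) (t : R),
      (support_function Z (row_mx x t%:M))%:E =
      ('E_P[fun w => (`|\sum_(i < n.-1) x 0 i * Gamma i w + t|)%R])%E)
    (s0 : R) (hs0 : 0 < s0)
    (hs0eq : erf (s0 / Num.sqrt pi) = s0 * expR (- (s0 ^+ 2 / pi))) :
  let b := expR (- (s0 ^+ 2 / pi)) * Num.sqrt (1 + s0 ^+ 2) in
  banach_mazur Z (@euclidean_ball R (n.-1 + 1)) = b^-1 /\
  exists2 rho : R, 0 < rho &
    dilate rho (@euclidean_ball R (n.-1 + 1)) `<=` Z /\
    Z `<=` dilate (b^-1 * rho) (@euclidean_ball R (n.-1 + 1)).
Proof.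
move=> b.
have suppE (x : 'rV[R]_n.-1) (t : R) : support_function Z (row_mx x t%:M) =
    if euclidean_norm x == 0 then `|t|
    else euclidean_norm x * profile (t / euclidean_norm x).
  by have := hsupp x t; rewrite expectation_abs_gaussian_form// => -[].
have w0 : profile_wronskian s0 = 0 by rewrite /profile_wronskian hs0eq subrr.
have s1 : 0 < 1 + s0 ^+ 2 by rewrite ltr_pwDl// sqr_ge0.
have b0 : 0 < b by rewrite mulr_gt0 ?expR_gt0// sqrtr_gt0.
have b2 : b ^+ 2 = profile_ratio s0.
  by rewrite profile_ratio_min// exprMn sqr_sqrtr// ltW.
have b1 : b <= 1.
  by rewrite -(@expr_le1 _ 2 _ isT (ltW b0)) b2 (profile_ratio_le1 hs0 w0)// ltW.
(* From here on [b] enters only through 0 < b <= 1 and b^2 = [profile_ratio s0]. *)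
clearbody b.
have profileP (s : R) : 0 < profile s /\
    b ^+ 2 * (1 + s ^+ 2) <= profile s ^+ 2 <= 1 + s ^+ 2.
  wlog s_ge0 : s / 0 <= s.
    move=> h; have [/h//|s_lt0] := leP 0 s.
    by rewrite -profileN -(sqrrN s); apply: h; rewrite oppr_ge0 ltW.
  have s2 : 0 < 1 + s ^+ 2 by rewrite ltr_pwDl// sqr_ge0.
  split; first exact: profile_gt0.
  rewrite b2 -ler_pdivlMr// (profile_ratio_ge hs0 w0)//=.
  by rewrite -[leRHS]mul1r -ler_pdivrMr// (profile_ratio_le1 hs0 w0).
have suppP u : b * euclidean_norm u <= support_function Z u <= euclidean_norm u.
  rewrite -[u]hsubmxK [rsubmx u]mx11_scalar.
  move: (lsubmx u) (rsubmx u 0 0) => x t.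
  have nE := sqr_norm_row_mx x t.
  move: (euclidean_norm_ge0 (row_mx x t%:M)) nE; rewrite suppE.
  move: (euclidean_norm (row_mx _ _)) (euclidean_norm_ge0 x) => N + N0.
  move: (euclidean_norm x) => r r0 NE.
  (* Nonnegativity of the support function allows both bounds to be compared after squaring, where
     [profileP] applies with s = t / r. *)
  suff [h0 hb] : 0 <= (if r == 0 then `|t| else r * profile (t / r)) /\
      b ^+ 2 * N ^+ 2 <= (if r == 0 then `|t| else r * profile (t / r)) ^+ 2 <= N ^+ 2.
    by rewrite -exprMn !ler_sqr ?nnegrE ?mulr_ge0 ?(ltW b0) in hb.
  rewrite NE; case: eqVneq => [->|rn0].
    rewrite expr0n/= add0r real_normK ?num_real// normr_ge0 lexx andbT; split=> //.
    by rewrite ler_piMl ?sqr_ge0// expr_le1// ltW.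
  have [p0 /andP[p1 p2]] := profileP (t / r).
  have rE : r ^+ 2 + t ^+ 2 = r ^+ 2 * (1 + (t / r) ^+ 2) by field.
  have r2 : 0 < r ^+ 2 by rewrite exprn_gt0// lt_neqAle eq_sym rn0.
  split; first by rewrite mulr_ge0// ltW.
  by rewrite rE (exprMn _ r) mulrCA (ler_pM2l r2) p1 (ler_pM2l r2) p2.
have [bZ Zb] := body_between_balls b0 b1 hZ suppP.
have c1 : 1 <= b^-1 by rewrite invf_ge1.
have cZ : compact Z by case: hZ.
split; last first.
  exists b => //; split=> // x /Zb.
  by rewrite mulVf ?gt_eqF// => x1; apply/dilate_ballE.
(* Dilating Z by 1 / b turns b B in Z in B into B in Z / b in B / b. *)
apply: (@banach_mazur_attained _ _ _ _ _ (b^-1)%:M) => //.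
- by rewrite unitmxE det_scalar unitfE expf_neq0// invr_neq0// gt_eqF.
- move=> u u1; exists (b *: u); last first.
    by rewrite mul_mx_scalar scalerA mulVf ?gt_eqF// scale1r.
  by apply: bZ; exists u.
- by move=> _ [z Zz <-]; exists z; [exact: Zb|rewrite mul_mx_scalar].
move=> a S a1 uS BS SB.
have a0 : 0 < a by rewrite (lt_le_trans _ a1).
(* The bound 2 <= n provides a unit vector [e] in the first factor. *)
have n0 : (0 < n.-1)%N by rewrite -subn1 subn_gt0.
pose e : 'rV[R]_n.-1 := delta_mx 0 (Ordinal n0).
have eN : euclidean_norm e = 1.
  rewrite /euclidean_norm /dot (bigD1 (Ordinal n0))//= big1 ?addr0.
    by rewrite !mxE !eqxx mulr1 sqrtr1.
  by move=> i ii; rewrite !mxE (negbTE ii) andbF mulr0.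
have suppe t : support_function Z (row_mx e t%:M) = profile t.
  by rewrite suppE eN oner_eq0 mul1r divr1.
have supp0 t : support_function Z (row_mx 0 t%:M) = `|t|.
  by rewrite suppE (_ : euclidean_norm _ == 0) // euclidean_norm_eq0.
(* On the sides [u] and [v] the support function equals the Euclidean norm, its largest possible
   value, while both diagonals point in directions where the ratio is minimal. *)
pose u := row_mx e (0 : R)%:M; pose v : 'rV[R]_(n.-1 + 1) := row_mx 0 s0%:M.
have uvD : u + v = row_mx e s0%:M.
  by rewrite add_row_mx addr0 -raddfD/= add0r.
have uvB : u - v = row_mx e (- s0)%:M.
  by rewrite opp_row_mx add_row_mx oppr0 addr0 -raddfN -raddfD/= add0r.
have p00 : profile (0 : R) = 1.
  by rewrite /profile expr0n/= !mul0r oppr0 expR0 addr0.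
have := @distance_to_ball_parallelogram _ _ Z S a u v cZ uS a0 BS SB.
rewrite uvD uvB !suppe supp0 p00 profileN (gtr0_norm hs0).
move=> /(_ ler01 (ltW hs0)); rewrite expr1n.
have -> : profile s0 ^+ 2 = b ^+ 2 * (1 + s0 ^+ 2).
  by rewrite b2 divfK// gt_eqF.
(* Cancelling 2 (1 + s0^2) leaves 1 <= (a b)^2. *)
rewrite -mulr2n -[in leRHS]mulr_natl mulrCA ler_pM2l// mulrA -[leLHS]mul1r.
rewrite ler_pM2r// -exprMn => ab.
rewrite -[leLHS]mul1r ler_pdivrMr//.
by rewrite -(@expr_ge1 _ 2 _ isT (mulr_ge0 (ltW a0) (ltW b0))).
Qed.
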